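(* Let $f:[a,b]\to\mathbb{R}$ be a continuous $\Phi$-H\''older function. Then for any even number $n\in\mathbb{N}$, $$\max\{f(a),f(b)\}-\frac{n}{2}\Phi\Big(\frac{b-a}{n}\Big)\leq\frac{1}{b-a}\mathcal{S}_{n}(f)\leq\min\{f(a),f(b)\}+\frac{n}{2}\Phi\Big(\frac{b-a}{n}\Big).$$
   Context: Let $a<b$ be real numbers. $\mathbb{N}$ denotes the set of positive integers and $\mathbb{R}_+$ the set of nonnegative reals. $\Phi:[0,b-a]\to\mathbb{R}_+$ is an arbitrary function (called the error function). A function $f:[a,b]\to\mathbb{R}$ is $\Phi$-monotone if $f(x)\leq f(y)+\Phi(y-x)$ for all $x,y\in[a,b]$ with $x<y$; it is $\Phi$-H\''older if both $f$ and $-f$ are $\Phi$-monotone, i.e. $|f(x)-f(y)|\leq\Phi(|y-x|)$ for all $x,y\in[a,b]$. For $n\in\mathbb{N}$ put $x_i=a+\frac{(b-a)i}{n}$, $i=0,1,\ldots,n$. For even $n\in\mathbb{N}$, Simpson's rule is $$\mathcal{S}_{n}(f)=\frac{b-a}{3n}\Big[f(x_0)+2\sum_{i=1}^{(n/2)-1}f(x_{2i})+4\sum_{i=1}^{n/2}f(x_{2i-1})+f(x_n)\Big].$$ *)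

(* Defs.v *)
(* A function on an interval [u, v] is represented by a total
   function R -> R of which only the values on [u, v] are constrained. *)
From HB Require Import structures.
From mathcomp Require Import all_boot all_order all_algebra.
From mathcomp Require Import all_classical all_reals all_analysis.

Set Implicit Arguments.
Unset Strict Implicit.
Unset Printing Implicit Defensive.

Import Order.TTheory GRing.Theory Num.Theory.
Import numFieldNormedType.Exports.

Local Open Scope classical_set_scope.
Local Open Scope ring_scope.

Definition error_function (R : realType) (a b : R) (Phi : R -> R) : Prop :=
  forall t, t \in `[0, b - a] -> 0 <= Phi t.

Definition Phi_monotone (R : realType) (a b : R) (Phi f : R -> R) : Prop :=
  forall x y, x \in `[a, b] -> y \in `[a, b] -> x < y ->
    f x <= f y + Phi (y - x).

Definition Phi_Holder (R : realType) (a b : R) (Phi f : R -> R) : Prop :=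
  Phi_monotone a b Phi f /\ Phi_monotone a b Phi (fun x => - f x).

Definition node (R : realType) (a b : R) (n i : nat) : R :=
  a + (b - a) * i%:R / n%:R.

(* Meaningful for even n > 0; the upper bounds of the sums are exclusive. *)
Definition simpson (R : realType) (a b : R) (n : nat) (f : R -> R) : R :=
  (b - a) / (3 * n%:R) *
    (f (node a b n 0)
     + 2 * (\sum_(1 <= i < n./2) f (node a b n (2 * i)%N))
     + 4 * (\sum_(1 <= i < (n./2).+1) f (node a b n (2 * i - 1)%N))
     + f (node a b n n)).

(* Main.v *)
Require Import Defs.
From HB Require Import structures.
From mathcomp Require Import all_boot all_order all_algebra.
From mathcomp Require Import all_classical all_reals all_analysis.
From mathcomp Require Import ring lra zify.
Import Order.TTheory GRing.Theory Num.Theory.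
Import numFieldNormedType.Exports.

Local Open Scope classical_set_scope.
Local Open Scope ring_scope.

(** Only consecutive nodes matter.  They lie [h = (b - a) / n] apart, so
    [Phi]-monotonicity lets [f] decrease by at most [e = Phi h] from one node to
    the next; chaining these steps towards either endpoint
    ([Phi_monotone_nodes]) gives, at every node [x],
    [f a - (x - a) / h * e <= f x <= f b + (b - x) / h * e].
    Both outer terms are affine in [x].  Simpson's rule has nonnegative weights,
    hence preserves these inequalities ([simpson_le]), and it is exact on affine
    functions, which it sends to [b - a] times their value at the midpoint
    ([simpson_affine]).  The midpoint is [n / 2] steps from each endpoint, and
    this yields [f a - n / 2 * e] and [f b + n / 2 * e] as bounds
    ([Phi_monotone_simpson]).  A Hölder function is one for which [- f] is
    [Phi]-monotone as well; applying the same bounds to [- f] exchanges the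
    roles of [f a] and [f b], which produces the maximum and the minimum. *)

Lemma node0 (R : realType) (a b : R) (n : nat) : node a b n 0 = a.
Proof. by rewrite /node mulr0 mul0r addr0. Qed.

Lemma node_last (R : realType) (a b : R) (n : nat) :
  (0 < n)%N -> node a b n n = b.
Proof.
move=> n_gt0; have n0 : n%:R != 0 :> R by rewrite pnatr_eq0 -lt0n.
by rewrite /node; field.
Qed.

Lemma node_step (R : realType) (a b : R) (n i : nat) :
  node a b n i.+1 - node a b n i = (b - a) / n%:R.
Proof. rewrite /node -natr1; ring. Qed.

Lemma node_in (R : realType) (a b : R) (n i : nat) :
  a <= b -> (0 < n)%N -> (i <= n)%N -> node a b n i \in `[a, b].
Proof.
move=> leab n_gt0 lein; have n0 : 0 < n%:R :> R by rewrite ltr0n.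
have ba0 : 0 <= b - a by rewrite subr_ge0.
rewrite in_itv /=; apply/andP; split.
  by rewrite /node lerDl divr_ge0 ?mulr_ge0 ?ler0n.
rewrite /node -lerBrDl ler_pdivrMr //.
by apply: ler_wpM2l => //; rewrite ler_nat.
Qed.

(** The node distance does not depend on the index, so each of the [j] steps
    costs the same error [Phi ((b - a) / n)]. *)
Lemma Phi_monotone_nodes (R : realType) (a b : R) (Phi f : R -> R)
    (n i j : nat) :
  a < b -> (0 < n)%N -> Phi_monotone a b Phi f -> (i + j <= n)%N ->
  f (node a b n i) <= f (node a b n (i + j)) + j%:R * Phi ((b - a) / n%:R).
Proof.
move=> ltab n_gt0 fmon; elim: j => [|j IHj] leijn.
  by rewrite addn0 mul0r addr0.
rewrite addnS in leijn *.
have ltn : (0 : R) < n%:R by rewrite ltr0n.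
have lt_step : node a b n (i + j) < node a b n (i + j).+1.
  by rewrite -subr_gt0 node_step divr_gt0 // subr_gt0.
have := fmon _ _ (node_in _ _ _ _ _ (ltW ltab) n_gt0 (ltnW leijn))
  (node_in _ _ _ _ _ (ltW ltab) n_gt0 leijn) lt_step.
rewrite node_step => step; have {IHj} le_ij := IHj (ltnW leijn).
apply: (le_trans le_ij); rewrite -natr1; lra.
Qed.

Lemma simpsonN (R : realType) (a b : R) (n : nat) (f : R -> R) :
  simpson a b n (fun x => - f x) = - simpson a b n f.
Proof. by rewrite /simpson !sumrN; ring. Qed.

(** The weights are nonnegative and every point at which the rule evaluates its
    argument is one of the nodes of index at most [n]. *)
Lemma simpson_le (R : realType) (a b : R) (n : nat) (f g : R -> R) :
  a <= b ->
  (forall i, (i <= n)%N -> f (node a b n i) <= g (node a b n i)) ->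
  simpson a b n f <= simpson a b n g.
Proof.
move=> leab lefg; rewrite /simpson.
apply: ler_wpM2l; first by rewrite divr_ge0 ?mulr_ge0 ?ler0n ?subr_ge0.
by apply: lerD; [apply: lerD; [apply: lerD|]|]; try exact: lefg;
  (apply: ler_wpM2l => //; apply: ler_sum_nat => i /andP[i_ge1 i_lt];
   apply: lefg; lia).
Qed.

(** The weights add up to [b - a] and are symmetric about the midpoint. Here
    this is verified by computing, with [n = 2 * m.+1], the sums of the
    arithmetic progressions formed by the values at the even and at the odd
    nodes. *)
Lemma simpson_affine (R : realType) (a b c d : R) (n : nat) :
  (0 < n)%N -> ~~ odd n ->
  simpson a b n (fun x => c + d * x) = (b - a) * (c + d * ((a + b) / 2)).
Proof.
move=> n_gt0 evenn; rewrite /simpson node0 node_last //.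
have n_eq : n = (2 * n./2)%N by lia.
move: n_eq; case: n./2 => [|m] n_eq; first by lia.
have nE : n%:R = 2 * (1 + m%:R) :> R by rewrite n_eq natrM nat1r.
have m0 : 1 + m%:R != 0 :> R by rewrite nat1r pnatr_eq0.
have nodeE k : c + d * node a b n k
    = (c + d * a) + (d * (b - a) / n%:R) * k%:R by rewrite /node; ring.
have evenE (u v : R) : \sum_(1 <= i < m.+1) (u + v * (2 * i)%:R)
    = m%:R * u + v * (m%:R * (m%:R + 1)).
  elim: (m) => [|k IHk]; first by rewrite big_geq //; ring.
  by rewrite big_nat_recr //= IHk natrM -natr1; ring.
have oddE (u v : R) (p : nat) : \sum_(1 <= i < p.+1) (u + v * (2 * i - 1)%:R)
    = p%:R * u + v * p%:R ^+ 2.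
  elim: p => [|k IHk]; first by rewrite big_geq //; ring.
  rewrite big_nat_recr //= IHk natrB; last by lia.
  by rewrite natrM -natr1; ring.
rewrite (eq_bigr _ (fun i _ => nodeE (2 * i)%N)) evenE.
rewrite (eq_bigr _ (fun i _ => nodeE (2 * i - 1)%N)) oddE.
by rewrite nE -nat1r; field.
Qed.

(** The one-sided form: [Phi]-monotonicity alone gives a lower bound from the
    left endpoint and an upper bound from the right one, by comparing [f] at the
    nodes with affine functions, on which the rule is exact. *)
Lemma Phi_monotone_simpson (R : realType) (a b : R) (Phi f : R -> R)
    (n : nat) :
  a < b -> (0 < n)%N -> ~~ odd n -> Phi_monotone a b Phi f ->
  f a - n%:R / 2 * Phi ((b - a) / n%:R) <= (b - a)^-1 * simpson a b n f
  /\ (b - a)^-1 * simpson a b n f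
    <= f b + n%:R / 2 * Phi ((b - a) / n%:R).
Proof.
move=> ltab n_gt0 evenn fmon; set e := Phi _.
have ba_gt0 : 0 < b - a by rewrite subr_gt0.
have ba0 : b - a != 0 by rewrite gt_eqF.
have n0 : n%:R != 0 :> R by rewrite pnatr_eq0 -lt0n.
(* Both comparison functions lose [e] over each step of length
   [(b - a) / n]; they differ only in the endpoint where they agree with [f]. *)
pose d := - (e * n%:R / (b - a)).
have lower i : (i <= n)%N ->
    (f a - d * a) + d * node a b n i <= f (node a b n i).
  move=> lein; have := Phi_monotone_nodes _ _ _ _ _ _ 0 i ltab n_gt0 fmon lein.
  rewrite node0 add0n -/e -lerBlDr; apply: le_trans.
  rewrite le_eqVlt; apply/orP; left; apply/eqP.
  by rewrite /d /node; field; rewrite n0.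
have upper i : (i <= n)%N ->
    f (node a b n i) <= (f b - d * b) + d * node a b n i.
  move=> lein; have le_n : (i + (n - i) <= n)%N by rewrite subnKC.
  have := Phi_monotone_nodes _ _ _ _ _ _ i (n - i) ltab n_gt0 fmon le_n.
  rewrite subnKC // node_last // natrB // -/e => /le_trans; apply.
  rewrite le_eqVlt; apply/orP; left; apply/eqP.
  by rewrite /d /node; field; rewrite n0.
split.
- rewrite ler_pdivlMl //.
  have := simpson_le _ _ _ _ (fun x => (f a - d * a) + d * x) f
    (ltW ltab) lower.
  rewrite simpson_affine //; congr (_ <= _); rewrite /d.
  by field.
- rewrite ler_pdivrMl //.
  have := simpson_le _ _ _ _ f (fun x => (f b - d * b) + d * x)
    (ltW ltab) upper.
  rewrite simpson_affine //; congr (_ <= _); rewrite /d.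
  by field.
Qed.

Theorem corollary3 (R : realType) (a b : R) (hab : a < b)
    (Phi : R -> R) (hPhi : error_function a b Phi)
    (f : R -> R) (hcont : {within `[a, b], continuous f})
    (hf : Phi_Holder a b Phi f)
    (n : nat) (hn : (0 < n)%N) (heven : ~~ odd n) :
  Num.max (f a) (f b) - n%:R / 2 * Phi ((b - a) / n%:R)
    <= (b - a)^-1 * simpson a b n f
  /\ (b - a)^-1 * simpson a b n f
    <= Num.min (f a) (f b) + n%:R / 2 * Phi ((b - a) / n%:R).
Proof.
have [fmon nfmon] := hf.
have [lo_a up_b] := Phi_monotone_simpson _ _ _ _ _ _ hab hn heven fmon.
have [] := Phi_monotone_simpson _ _ _ _ _ _ hab hn heven nfmon.
rewrite simpsonN mulrN => up_a lo_b.
split.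
- rewrite lerBlDr ge_max; apply/andP; split; lra.
- rewrite -lerBlDr le_min; apply/andP; split; lra.
Qed.
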